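(* Let $n\ge3$ and let $a_1,\dots,a_n$ be pairwise relatively prime integers with $a_k\ge2$ for all $k$. Let $L(\overline{\mathcal P},t)$, for positive integers $t$, be the number of $(m_1,\dots,m_n)\in\mathbb Z^n$ with all $m_k\ge0$ and $\sum_{k=1}^n m_k/a_k\le t$, and let $c_n t^n+\dots+c_1t+c_0$ be the polynomial agreeing with $L(\overline{\mathcal P},t)$ for all positive integers $t$. Put $A=a_1\cdots a_n$, $A_k=A/a_k$, and for $1\le j<k\le n$, $A_{j,k}=A/(a_ja_k)$. Then \[ c_{n-2}=\frac{1}{(n-2)!}\Big(C_n-\mathfrak s(A_1,a_1)-\dots-\mathfrak s(A_n,a_n)\Big), \] where \[ C_n=\frac14\Big(n+\sum_{1\le j<k\le n}A_{j,k}\Big)+\frac1{12}\Big(\frac1A+\frac{A_1}{a_1}+\dots+\frac{A_n}{a_n}\Big). \]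
   Context: $\mathfrak s(a,b)$ is the Dedekind sum: for integers $a$ and $b\ge 1$ with $\gcd(a,b)=1$, $\mathfrak s(a,b)=\frac1{4b}\sum_{k=1}^{b-1}\cot\frac{\pi k a}{b}\cot\frac{\pi k}{b}$ (equivalently $\sum_{k=1}^{b-1}((k/b))((ka/b))$ with $((x))=x-\lfloor x\rfloor-\tfrac12$ for $x\notin\mathbb Z$ and $0$ otherwise). *)

(* Defs.v *)
From HB Require Import structures.
From mathcomp Require Import all_boot all_order all_algebra finmap.
From mathcomp Require Import boolp classical_sets functions cardinality.
From mathcomp Require Import reals trigo.

Set Implicit Arguments.
Unset Strict Implicit.
Unset Printing Implicit Defensive.

Import Order.TTheory GRing.Theory Num.Theory.
Local Open Scope classical_set_scope.
Local Open Scope ring_scope.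

Definition cot (R : realType) (x : R) : R := cos x / sin x.

(* Only meant for [0 < b] and [a] coprime to [b]: then no cotangent below is
   evaluated at a multiple of [pi]. *)
Definition dedekind_sum (R : realType) (a : int) (b : nat) : R :=
  (4 * b%:R)^-1 *
  \sum_(1 <= k < b) cot (pi * k%:R * a%:~R / b%:R) * cot (pi * k%:R / b%:R).

(* Integer points of the dilate by [t] of the closed simplex with vertices 0
   and [a k] times the [k]-th unit vector. *)
Definition simplex_points (n : nat) (a : 'I_n -> nat) (t : nat) :
    set {ffun 'I_n -> int} :=
  [set m | (forall k, 0 <= m k) /\
           \sum_k (m k)%:~R / (a k)%:R <= t%:R :> rat].

(* [fset_set] sends infinite sets to the empty set;
   [finite_simplex_points] shows that this case does not occur. *)
Definition lattice_count (n : nat) (a : 'I_n -> nat) (t : nat) : nat :=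
  #|` fset_set (simplex_points a t)|%fset.

Lemma finite_simplex_points (n : nat) (a : 'I_n -> nat) (t : nat) :
  (forall k, (0 < a k)%N) -> finite_set (simplex_points a t).
Proof.
move=> a_gt0; pose N := (\sum_k t * a k)%N.
pose f (u : {ffun 'I_n -> 'I_N.+1}) : {ffun 'I_n -> int} :=
  [ffun k => (u k : nat)%:Z].
apply: (@sub_finite_set _ _ (f @` setT)); last first.
  exact: finite_image.
move=> m [m_ge0 m_le]; exists [ffun k => inord `|m k|%N] => //.
apply/ffunP => k; rewrite !ffunE inordK; first by rewrite gez0_abs.
rewrite ltnS; apply: (@leq_trans (t * a k)%N); last first.
  by rewrite /N (bigD1 k) //= leq_addr.
have ak_gt0 : (0 : rat) < (a k)%:R by rewrite ltr0n.
have le_k : (m k)%:~R / (a k)%:R <= t%:R :> rat.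
  apply: le_trans m_le; rewrite (bigD1 k) //= lerDl sumr_ge0 // => j _.
  by rewrite divr_ge0 ?ler0z ?ler0n.
move: le_k; rewrite ler_pdivrMr // -natrM -(gez0_abs (m_ge0 k)).
by rewrite -pmulrn ler_nat.
Qed.

Definition prodA (n : nat) (a : 'I_n -> nat) : nat := (\prod_k a k)%N.

Definition prodA1 (n : nat) (a : 'I_n -> nat) (k : 'I_n) : nat :=
  (prodA a %/ a k)%N.

Definition prodA2 (n : nat) (a : 'I_n -> nat) (j k : 'I_n) : nat :=
  (prodA a %/ (a j * a k))%N.

Definition constC (R : realType) (n : nat) (a : 'I_n -> nat) : R :=
  1 / 4 * (n%:R + \sum_(j < n) \sum_(k < n | (j < k)%N) (prodA2 a j k)%:R)
  + 1 / 12 * (1 / (prodA a)%:R + \sum_(k < n) (prodA1 a k)%:R / (a k)%:R).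

(* Main.v *)
Require Import Defs.
From mathcomp Require Import all_boot all_order all_algebra.
From mathcomp Require Import reals trigo.
From mathcomp Require Import finmap classical_sets cardinality.
From mathcomp Require unstable.
From mathcomp Require Import ring zify.

(** Sort the lattice points [m] of the dilated simplex by the residue [r] of
    [- \sum_k m_k A_k] modulo [A].  By coprimality [r] determines the residues
    [d_k] of the [m_k] modulo [a_k], so the class of [r] consists of the points
    [d_k + a_k q_k] with [q_k >= 0] and [\sum_k q_k <= t - l(r)], where
    [l(r) = r / A + \sum_k d_k / a_k] is an integer between [0] and [n].  Hence
    the lattice count is [\sum_(r < A) 'C(t + n - l(r), n)], a polynomial in
    [t], and [(n-2)! c_(n-2)] is half the sum over [r] of
    [(l(r) - (n+1)/2)^2 - (n+1)/12].  Now [l(r) - (n+1)/2] is the sum of the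
    centered residues [d_k / a_k - 1/2] and [r / A - 1/2], whose second moments
    are elementary except for the correlations of [d_k] with [r].  Summing over
    the [r] with given [d_k] turns these into correlations of sawtooth functions
    modulo [a_k], and finite Fourier analysis identifies those with the
    cotangent sums [s(A_k, a_k)]. *)

Set Implicit Arguments.
Unset Strict Implicit.
Unset Printing Implicit Defensive.

Import Order.TTheory GRing.Theory Num.Theory.
Local Open Scope ring_scope.

(** * Residues *)

Lemma big_ord_muln (V : nmodType) (b q : nat) (g : nat -> V) :
  \sum_(r < b * q) g r = \sum_(x < b) \sum_(y < q) g (x + b * y)%N.
Proof.
elim: q => [|q IHq].
  by rewrite muln0 big_ord0 big1 // => x _; rewrite big_ord0.
rewrite mulnSr big_split_ord /= IHq -big_split /=.
by apply: eq_bigr => x _; rewrite big_ord_recr /= addnC.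
Qed.

Lemma eqn_modMl_coprime (b a x y : nat) : coprime b a ->
  (a * x == a * y %[mod b]) = (x == y %[mod b]).
Proof.
move=> co_ba; rewrite -!eqz_nat -!modz_nat !eqz_mod_dvd !PoszM -mulrBr.
by rewrite Gauss_dvdzr.
Qed.

Lemma sum_affine_modn (V : nmodType) (g : nat -> V) (x a b : nat) :
  (0 < b)%N -> coprime b a ->
  \sum_(y < b) g ((x + a * y) %% b)%N = \sum_(z < b) g z.
Proof.
move=> b_gt0 co_ba; pose h (y : 'I_b) := Ordinal (ltn_pmod (x + a * y) b_gt0).
suff h_inj : injective h by rewrite [RHS](reindex_inj h_inj).
move=> y z /(congr1 val) /= /eqP.
by rewrite eqn_modDl eqn_modMl_coprime // !modn_small // => /eqP /val_inj.
Qed.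

Lemma sum_affine_modn_muln (V : nmodType) (g : nat -> V) (x a b q : nat) :
  (0 < b)%N -> coprime b a ->
  \sum_(y < b * q) g ((x + a * y) %% b)%N = (\sum_(z < b) g z) *+ q.
Proof.
move=> b_gt0 co_ba; rewrite -(sum_affine_modn g x b_gt0 co_ba) -sumrMnl.
rewrite (big_ord_muln b q (fun y => g ((x + a * y) %% b)%N)).
apply: eq_bigr => y _; rewrite -[q in RHS]card_ord -sumr_const.
by apply: eq_bigr => z _; rewrite mulnDr mulnCA addnA addnC mulnC modnMDl.
Qed.

Lemma modz_natP (x : int) (b : nat) : (0 < b)%N ->
  exists2 r : nat, (r < b)%N & (x %% b)%Z = r.
Proof.
move=> b_gt0; have bz0 : b%:Z != 0 by rewrite eqz_nat -lt0n.
have x_modE : (x %% b)%Z = `|(x %% b)%Z|%N by rewrite gez0_abs ?modz_ge0.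
exists `|(x %% b)%Z|%N; last exact: x_modE.
by rewrite -ltz_nat -x_modE ltz_pmod // ltz_nat.
Qed.

Lemma sum_mulr_eqmod (R : pzRingType) (g : int -> R) (b : nat) (x : int) :
  (0 < b)%N -> \sum_(s < b) g s * (b %| x - s%:Z)%Z%:R = g (x %% b)%Z.
Proof.
move=> b_gt0; have [r r_lt xE] := modz_natP x b_gt0.
have eqmodE (s : 'I_b) : (b %| x - s%:Z)%Z = (r == s).
  by rewrite -eqz_mod_dvd xE modz_small ?ltz_nat ?ltn_ord.
rewrite (bigD1 (Ordinal r_lt)) //= big1 => [|s s_neq]; last first.
  move: s_neq; rewrite eqmodE eq_sym -val_eqE => /negbTE /= ->.
  by rewrite mulr0.
by rewrite (eqmodE (Ordinal r_lt)) eqxx mulr1 addr0 xE.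
Qed.

Lemma dvdn_addn1_coprime (b a v : nat) : (b %| a * v + 1)%N -> coprime b v.
Proof.
move=> dvd_b; rewrite /coprime -dvdn1 -(@dvdn_addr (a * v)%N).
  exact: dvdn_trans (dvdn_gcdl b v) dvd_b.
by rewrite dvdn_mull // dvdn_gcdr.
Qed.

Lemma dvdn_addM_neg_inv (b a v r m : nat) : (b %| a * v + 1)%N ->
  (b %| r + m * a)%N = (m %% b == v * r %% b)%N.
Proof.
move=> dvd_b; rewrite -(Gauss_dvdr (r + m * a) (dvdn_addn1_coprime dvd_b)).
rewrite -(eqn_modDr (v * (m * a))) -mulnDr.
have -> : (m + v * (m * a) = m * (a * v + 1))%N by ring.
by rewrite /dvdn eq_sym (eqP (dvdn_mull m dvd_b)).
Qed.

Definition neg_inv_mod (b a : nat) : nat := (egcdn b a).2.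

Lemma neg_inv_modP (b a : nat) : (0 < b)%N -> coprime b a ->
  (b %| a * neg_inv_mod b a + 1)%N.
Proof.
move=> b_gt0 co_ba; rewrite /neg_inv_mod.
case: egcdnP => // u v uv _ /=.
by rewrite mulnC -(eqP co_ba) -uv dvdn_mull.
Qed.

(** * Moments of centered residues *)

Lemma sqr_sum (R : comPzRingType) (n : nat) (x : 'I_n -> R) :
  (\sum_k x k) ^+ 2 =
  \sum_k x k ^+ 2 + (\sum_(j < n) \sum_(k < n | (j < k)%N) x j * x k) *+ 2.
Proof.
rewrite expr2 big_distrlr /=.
transitivity (\sum_(i < n) (x i ^+ 2 + (\sum_(k < n | (i < k)%N) x i * x k +
   \sum_(k < n | (k < i)%N) x i * x k))).
  apply: eq_bigr => i _; rewrite (bigD1 i) //= -expr2; congr (_ + _).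
  rewrite (bigID (fun k : 'I_n => (i < k)%N)) /=.
  by congr (_ + _); apply: eq_bigl => k; rewrite -val_eqE /=; lia.
rewrite !big_split mulr2n; congr (_ + (_ + _)) => /=.
rewrite (exchange_big_dep xpredT) //=; apply: eq_bigr => i _.
by apply: eq_bigr => k _; rewrite mulrC.
Qed.

Definition centered (R : unitRingType) (b z : nat) : R := z%:R / b%:R - 2^-1.

Section CenteredMoments.
Variable R : numFieldType.
Implicit Types b x q N : nat.
Local Notation centered := (centered R).

Lemma sum_natr N : \sum_(i < N) (i%:R : R) = N%:R * (N%:R - 1) / 2.
Proof.
elim: N => [|N IHN]; first by rewrite big_ord0 !mul0r.
by rewrite big_ord_recr /= IHN -[N.+1%:R]natr1; field.
Qed.

Lemma sum_natr_sqr N :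
  \sum_(i < N) (i%:R ^+ 2 : R) = N%:R * (N%:R - 1) * (2 * N%:R - 1) / 6.
Proof.
elim: N => [|N IHN]; first by rewrite big_ord0 !mul0r.
by rewrite big_ord_recr /= IHN -[N.+1%:R]natr1; field.
Qed.

(* The multiplication formula of the Bernoulli polynomial [B_1 = x - 1 / 2]. *)
Lemma sum_centered_progression b q x : (0 < b)%N -> (0 < q)%N ->
  \sum_(y < q) centered (b * q) (x + b * y) = centered b x.
Proof.
move=> b_gt0 q_gt0; have b0 : b%:R != 0 :> R by rewrite pnatr_eq0 -lt0n.
have q0 : q%:R != 0 :> R by rewrite pnatr_eq0 -lt0n.
transitivity (\sum_(y < q) (y%:R / q%:R + (x%:R / (b * q)%:R - 2^-1)) : R).
  apply: eq_bigr => y _; rewrite /centered natrD !natrM.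
  by field; rewrite b0 q0.
rewrite big_split /= -mulr_suml sum_natr sumr_const card_ord -mulr_natr natrM.
by rewrite /centered; field; rewrite b0 q0.
Qed.

Lemma sum_centered b : (0 < b)%N -> \sum_(z < b) centered b z = - 2^-1.
Proof.
move=> b_gt0; have := sum_centered_progression 0 (isT : (0 < 1)%N) b_gt0.
under eq_bigr => z _ do rewrite !mul1n.
by move=> ->; rewrite /centered mul0r sub0r.
Qed.

Lemma sum_centered_sqr b : (0 < b)%N ->
  \sum_(z < b) centered b z ^+ 2 = b%:R / 12 + (6 * b%:R)^-1.
Proof.
move=> b_gt0; have b0 : b%:R != 0 :> R by rewrite pnatr_eq0 -lt0n.
transitivity (\sum_(z < b) (z%:R ^+ 2 / b%:R ^+ 2 - z%:R / b%:R + 4^-1) : R).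
  by apply: eq_bigr => z _; rewrite /centered; field.
rewrite big_split sumrB /= -!mulr_suml sum_natr sum_natr_sqr.
by rewrite sumr_const card_ord -mulr_natr; field.
Qed.

End CenteredMoments.

(** * The sawtooth function *)

(* [sawtooth b x] is [((x / b))]. *)
Definition sawtooth (R : unitRingType) (b : nat) (x : int) : R :=
  if (b %| x)%Z then 0 else centered R b `|(x %% b)%Z|.

Section Sawtooth.
Variable R : numFieldType.
Implicit Types (b : nat) (x y : int).
Local Notation sawtooth := (sawtooth R).

Lemma eq_sawtooth b x y : (x = y %[mod b])%Z -> sawtooth b x = sawtooth b y.
Proof. by move=> xy; rewrite /sawtooth !(sameP dvdz_mod0P eqP) xy. Qed.

Lemma sawtoothN b x : (0 < b)%N -> sawtooth b (- x) = - sawtooth b x.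
Proof.
move=> b_gt0; have b0 : b%:R != 0 :> R by rewrite pnatr_eq0 -lt0n.
rewrite /sawtooth rpredN; case: ifPn => [_|ndvd]; first by rewrite oppr0.
have [r r_lt xE] := modz_natP x b_gt0.
have r_gt0 : (0 < r)%N by rewrite lt0n -eqz_nat -xE (sameP eqP dvdz_mod0P).
have -> : (- x %% b)%Z = (b - r)%N.
  by rewrite -modzNm xE -modzDl subzn ?(ltnW r_lt) // modz_small //; lia.
by rewrite xE /centered natrB ?(ltnW r_lt) //; field.
Qed.

Lemma sawtooth_nat b z :
  sawtooth b z%:Z = if (b %| z)%N then 0 else centered R b (z %% b).
Proof. by rewrite /sawtooth dvdzE modz_nat. Qed.

Lemma sum_sawtoothM b v : (0 < b)%N -> coprime b v ->
  \sum_(x < b) sawtooth b x * sawtooth b (v * x)%N =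
  \sum_(x < b) centered R b x * centered R b (v * x %% b) - 4^-1.
Proof.
move=> b_gt0 co_bv; pose i0 := Ordinal b_gt0.
rewrite (bigD1 i0) // [in RHS](bigD1 i0) //=.
rewrite muln0 mod0n {1}/sawtooth dvdz0 mul0r add0r.
have -> : centered R b 0 * centered R b 0 = 4^-1.
  by rewrite /centered mul0r sub0r; field.
rewrite [RHS]addrC addKr; apply: eq_bigr => x x_neq0.
have x_gt0 : (0 < x)%N by rewrite lt0n.
have ndvd : (b %| x)%N = false by rewrite gtnNdvd.
by rewrite !sawtooth_nat Gauss_dvdr // ndvd modn_small.
Qed.

End Sawtooth.

(** * The Dedekind sum as a sawtooth correlation *)

Lemma periodicz (U V : zmodType) (f : U -> V) (T : U) :
  periodic f T -> forall (m : int) u, f (u + T *~ m) = f u.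
Proof.
move=> f_periodic [] m u; first exact: periodicn.
by rewrite NegzE mulrNz -(periodicn f_periodic m.+1) subrK.
Qed.

Section Trigonometry.
Context {R : realType}.
Implicit Types (x y : R) (b k r s N : nat) (m p q : int).
Local Notation sawtooth := (sawtooth R).

Lemma sinD2piz x m : sin (x + 2 * pi * m%:~R) = sin x.
Proof. by rewrite -[RHS](periodicz (@sinD2pi R) m) mulr_natl mulrzr. Qed.

Lemma cosD2piz x m : cos (x + 2 * pi * m%:~R) = cos x.
Proof. by rewrite -[RHS](periodicz (@cosD2pi R) m) mulr_natl mulrzr. Qed.

Lemma sin_2piz m : sin (2 * pi * m%:~R) = 0 :> R.
Proof. by rewrite -[X in sin X]add0r sinD2piz sin0. Qed.

Lemma cos_2piz m : cos (2 * pi * m%:~R) = 1 :> R.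
Proof. by rewrite -[X in cos X]add0r cosD2piz cos0. Qed.

Lemma sin_pi_frac_eq0 b m : (0 < b)%N ->
  (sin (pi * m%:~R / b%:R) == 0 :> R) = (b %| m)%Z.
Proof.
move=> b_gt0; have b0 : b%:R != 0 :> R by rewrite pnatr_eq0 -lt0n.
have sin_sqr_periodic : periodic (fun x : R => sin x ^+ 2) pi.
  by move=> x; rewrite sinDpi sqrrN.
have [r r_lt mE] := modz_natP m b_gt0.
have -> : pi * m%:~R / b%:R = pi * r%:R / b%:R + pi *~ (m %/ b)%Z :> R.
  rewrite {1}(divz_eq m b) mE rmorphD rmorphM /= -!pmulrn -[pi *~ _]mulrzr.
  by field.
rewrite -sqrf_eq0 (periodicz sin_sqr_periodic) sqrf_eq0.
rewrite (sameP dvdz_mod0P eqP) mE eqz_nat.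
have [->|r_gt0] := posnP r; first by rewrite mulr0 mul0r sin0 eqxx.
apply/negbTE/lt0r_neq0/sin_gt0_pi.
rewrite divr_gt0 ?mulr_gt0 ?pi_gt0 ?ltr0n //=.
by rewrite ltr_pdivrMr ?ltr0n // ltr_pM2l ?pi_gt0 // ltr_nat.
Qed.

Lemma sum_cos_progression x y N :
  2 * sin y * \sum_(r < N) cos (x + 2 * r%:R * y) =
  sin (x + 2 * N%:R * y - y) - sin (x - y).
Proof.
elim: N => [|N IHN]; first by rewrite big_ord0 !(mulr0, mul0r) addr0 subrr.
rewrite big_ord_recr /= mulrDr IHN -[N.+1%:R]natr1.
have -> : x + 2 * (N%:R + 1) * y - y = x + 2 * N%:R * y + y by ring.
by rewrite [in RHS]sinD sinB; ring.
Qed.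

Lemma sum_affine_sin (z y : R) N :
  2 * sin y * \sum_(r < N) (r%:R + z) * sin (2 * r%:R * y) =
  \sum_(r < N) cos (y + 2 * r%:R * y) + z * cos y
  - (N%:R + z) * cos (2 * N%:R * y - y).
Proof.
elim: N => [|N IHN].
  by rewrite !big_ord0 !(mulr0, mul0r) !add0r cosN subrr.
rewrite !big_ord_recr /= mulrDr IHN -[N.+1%:R]natr1.
have -> : 2 * (N%:R + 1) * y - y = y + 2 * N%:R * y by ring.
by rewrite cosB cosD; ring.
Qed.

Lemma sum_cos_2pi_frac b m : (0 < b)%N ->
  \sum_(k < b) cos (2 * pi * k%:R * m%:~R / b%:R) = b%:R * (b %| m)%Z%:R :> R.
Proof.
move=> b_gt0; have b0 : b%:R != 0 :> R by rewrite pnatr_eq0 -lt0n.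
have [/dvdzP [q ->]|ndvd] := boolP (b %| m)%Z.
  rewrite mulr1 -[b in RHS]card_ord -sumr_const; apply: eq_bigr => k _.
  rewrite -[RHS](cos_2piz (k%:Z * q)); congr cos.
  by rewrite !intrM; field.
have sin_neq0 : 2 * sin (pi * m%:~R / b%:R : R) != 0.
  by rewrite mulf_neq0 ?pnatr_eq0 ?sin_pi_frac_eq0.
apply: (mulfI sin_neq0); rewrite !mulr0.
rewrite -[RHS](subrr (sin (0 - pi * m%:~R / b%:R))) -[X in X - _](sinD2piz _ m).
have -> : 0 - pi * m%:~R / b%:R + 2 * pi * m%:~R =
  0 + 2 * b%:R * (pi * m%:~R / b%:R) - pi * m%:~R / b%:R :> R by field.
rewrite -sum_cos_progression; congr (_ * _).
by apply: eq_bigr => k _; congr cos; field.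
Qed.

Lemma sum_sin_sin b p q : (0 < b)%N ->
  2 * \sum_(k < b) sin (2 * pi * k%:R * p%:~R / b%:R) *
                   sin (2 * pi * k%:R * q%:~R / b%:R) =
  b%:R * ((b %| p - q)%Z%:R - (b %| p + q)%Z%:R) :> R.
Proof.
move=> b_gt0; rewrite mulrBr -!sum_cos_2pi_frac // -sumrB mulr_sumr.
apply: eq_bigr => k _; pose w : R := 2 * pi * k%:R / b%:R.
have wE m : 2 * pi * k%:R * m%:~R / b%:R = w * m%:~R by rewrite mulrAC.
by rewrite !wE rmorphB rmorphD mulrBr mulrDr cosB cosD; ring.
Qed.

(* For [m] a multiple of [b] both sides are [0], as [cot] is then [cos / 0]. *)
Lemma cot_sawtooth b m : (0 < b)%N ->
  cot (pi * m%:~R / b%:R) =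
  - 2 * \sum_(r < b) sawtooth b r * sin (2 * pi * m%:~R * r%:R / b%:R).
Proof.
move=> b_gt0; have b0 : b%:R != 0 :> R by rewrite pnatr_eq0 -lt0n.
have [/dvdzP [q ->]|ndvd] := boolP (b %| m)%Z.
  rewrite big1 => [|r _].
    have /eqP sin_eq0 : sin (pi * (q * b)%:~R / b%:R) == 0 :> R.
      by rewrite sin_pi_frac_eq0 // dvdz_mull.
    by rewrite /cot sin_eq0 invr0 !mulr0.
  rewrite (_ : _ / _ = 2 * pi * (q * r)%:~R); last by rewrite !intrM; field.
  by rewrite sin_2piz mulr0.
set y : R := pi * m%:~R / b%:R.
have y_mulb : 2 * b%:R * y = 2 * pi * m%:~R by rewrite /y; field.
have sin_neq0 : sin y != 0 by rewrite sin_pi_frac_eq0.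
have sin2_neq0 : 2 * sin y != 0 by rewrite mulf_neq0 ?pnatr_eq0.
have sum_cos_eq0 : \sum_(r < b) cos (y + 2 * r%:R * y) = 0.
  apply: (mulfI sin2_neq0); rewrite sum_cos_progression mulr0 addrAC subrr.
  by rewrite add0r y_mulb sin_2piz sin0 subrr.
have -> : \sum_(r < b) sawtooth b r * sin (2 * pi * m%:~R * r%:R / b%:R) =
    (\sum_(r < b) (r%:R - b%:R / 2) * sin (2 * r%:R * y)) / b%:R.
  rewrite mulr_suml; apply: eq_bigr => r _.
  have -> : 2 * pi * m%:~R * r%:R / b%:R = 2 * r%:R * y by rewrite /y; field.
  have [->|r_gt0] := posnP r; first by rewrite mulr0 mul0r sin0 !mulr0 mul0r.
  by rewrite sawtooth_nat gtnNdvd // modn_small // /centered; field.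
set S := \sum_(r < b) _.
have SE : 2 * sin y * S = - b%:R * cos y.
  rewrite sum_affine_sin sum_cos_eq0 y_mulb [_ - y]addrC cosD2piz cosN.
  by ring.
transitivity (- (2 * sin y * S) / (b%:R * sin y)); last first.
  by field; rewrite b0 sin_neq0.
by rewrite SE /cot; field; rewrite b0 sin_neq0.
Qed.

Lemma sine_parseval b (p : int) (f g : int -> R) : (0 < b)%N ->
  2 * \sum_(k < b)
    (\sum_(r < b) f r * sin (2 * pi * k%:R * (p * r%:Z)%:~R / b%:R)) *
    (\sum_(s < b) g s * sin (2 * pi * k%:R * s%:R / b%:R)) =
  b%:R * \sum_(r < b) f r * (g ((p * r%:Z) %% b)%Z - g (- (p * r%:Z) %% b)%Z).
Proof.
move=> b_gt0; under eq_bigr => k _ do rewrite mulr_suml.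
rewrite exchange_big !mulr_sumr /=; apply: eq_bigr => r _.
under eq_bigr => k _ do rewrite mulr_sumr.
rewrite exchange_big -!sum_mulr_eqmod // -sumrB !mulr_sumr /=.
apply: eq_bigr => s _.
have -> : (b %| - (p * r%:Z) - s%:Z)%Z = (b %| p * r%:Z + s%:Z)%Z.
  by rewrite -opprD rpredN.
rewrite -mulrBr [RHS]mulrCA [X in _ = f r * X]mulrCA -sum_sin_sin //.
rewrite !mulr_sumr; apply: eq_bigr => k _.
by rewrite mulrACA [LHS]mulrCA [RHS]mulrA.
Qed.

Lemma dedekind_sum_sawtooth (a : int) b : (0 < b)%N ->
  dedekind_sum R a b = \sum_(r < b) sawtooth b r * sawtooth b (a * r%:Z).
Proof.
move=> b_gt0; have b0 : b%:R != 0 :> R by rewrite pnatr_eq0 -lt0n.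
pose cots k : R := cot (pi * k%:R * a%:~R / b%:R) * cot (pi * k%:R / b%:R).
have cots0 : cots 0 = 0.
  by rewrite /cots /cot [_ * 0%:R]mulr0 !mul0r sin0 invr0 !mulr0.
rewrite /dedekind_sum -/cots.
have -> : \sum_(1 <= k < b) cots k = \sum_(k < b) cots k.
  by rewrite -(big_mkord xpredT cots) [RHS]big_ltn // cots0 add0r.
have cotsE k : cots k = 4 *
    ((\sum_(r < b) sawtooth b r *
        sin (2 * pi * k%:R * (a * r%:Z)%:~R / b%:R)) *
     (\sum_(s < b) sawtooth b s * sin (2 * pi * k%:R * s%:R / b%:R))).
  rewrite /cots -[pi * _ * _]mulrA -[k%:R]/(k%:Z%:~R) -rmorphM !cot_sawtooth //.
  rewrite mulrACA mulrNN -natrM; congr (_ * (_ * _)); apply: eq_bigr => r _.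
  by rewrite !rmorphM /= !mulrA.
under eq_bigr => k _ do rewrite cotsE.
rewrite -mulr_sumr; set T := \sum_(k < b) _.
transitivity ((2 * b%:R)^-1 * (2 * T)); first by field.
rewrite sine_parseval // invfM -mulrA mulKf // mulr_sumr.
apply: eq_bigr => r _; rewrite !(eq_sawtooth _ (modz_mod _ _)) sawtoothN //.
by field.
Qed.

(* Reindex the sum by [r |-> v r], which [a] maps back to [- r]. *)
Lemma dedekind_sum_neg_inv a v b : (0 < b)%N -> (b %| a * v + 1)%N ->
  dedekind_sum R a%:Z b =
  - \sum_(r < b) sawtooth b r * sawtooth b (v * r)%N.
Proof.
move=> b_gt0 dvd_b; rewrite dedekind_sum_sawtooth //.
rewrite -(sum_affine_modn (fun z => sawtooth b z * sawtooth b (a%:Z * z)) 0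
  b_gt0 (dvdn_addn1_coprime dvd_b)) -sumrN.
apply: eq_bigr => r _; rewrite add0n mulrC -mulNr; congr (_ * _).
  rewrite -sawtoothN //; apply/eq_sawtooth/eqP.
  rewrite eqz_mod_dvd opprK -PoszM -PoszD addnC mulnC dvdzE.
  by rewrite (dvdn_addM_neg_inv _ _ dvd_b) modn_mod.
by apply: eq_sawtooth; rewrite -modz_nat modz_mod.
Qed.

End Trigonometry.

(** * Lattice points sorted by residue class *)

Lemma card_tuple_sum_le l N s : (s <= N)%N ->
  #|[pred q : l.-tuple 'I_N.+1 | (\sum_k tnth q k <= s)%N]| = 'C(l + s, l).
Proof.
move=> s_le; rewrite -card_partial_ord_partitions.
pose widen (q : l.-tuple 'I_s.+1) : l.-tuple 'I_N.+1 :=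
  map_tuple (widen_ord (s_le : (s.+1 <= N.+1)%N)) q.
have widen_inj : injective widen.
  move=> q q' /(congr1 val) /= /inj_map q_eq; apply/val_inj/q_eq.
  by move=> x y /(congr1 val) /= xy; exact: val_inj.
rewrite -(card_imset _ widen_inj); apply: eq_card => q; rewrite !inE.
apply/idP/imsetP => [q_le|[q' q'_le ->]]; last first.
  move: q'_le; rewrite inE big_tuple => q'_le.
  by under eq_bigr => k _ do rewrite tnth_map /=.
have q_lt k : (tnth q k < s.+1)%N.
  by rewrite ltnS (leq_trans _ q_le) // (bigD1 k) //= leq_addr.
exists [tuple Ordinal (q_lt k) | k < l].
  by rewrite inE big_tuple; under eq_bigr => k _ do rewrite tnth_mktuple /=.
by apply: eq_from_tnth => k; rewrite tnth_map tnth_mktuple; exact: val_inj.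
Qed.

Section LatticePoints.
Context {n : nat} (a : 'I_n -> nat).
Hypothesis a_gt0 : forall k, (0 < a k)%N.
Hypothesis a_coprime : forall j k, j != k -> coprime (a j) (a k).
Implicit Types (j k : 'I_n) (m q : 'I_n -> nat) (r t : nat).
Local Notation A := (prodA a).
Local Notation A_ := (prodA1 a).

Lemma prodA_gt0 : (0 < A)%N.
Proof. exact: prodn_gt0. Qed.

Lemma prodA1E k : A_ k = (\prod_(j | j != k) a j)%N.
Proof. by rewrite /prodA1 /prodA (bigD1 k) //= mulKn. Qed.

Lemma prodA1_gt0 k : (0 < A_ k)%N.
Proof. by rewrite prodA1E prodn_gt0. Qed.

Lemma mul_prodA1 k : (a k * A_ k)%N = A.
Proof. by rewrite prodA1E /prodA [in RHS](bigD1 k). Qed.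

Lemma mul_prodA2 j k : j != k -> (a k * prodA2 a j k)%N = A_ j.
Proof.
move=> jk; rewrite /prodA2 -(mul_prodA1 j) divnMl ?a_gt0 //.
by rewrite mulnC divnK // prodA1E (bigD1 k) ?dvdn_mulr // eq_sym.
Qed.

Lemma dvdn_prodA1 j k : j != k -> (a j %| A_ k)%N.
Proof. by move=> jk; rewrite prodA1E (bigD1 j) //= dvdn_mulr. Qed.

Lemma coprime_prodA1 k : coprime (a k) (A_ k).
Proof.
rewrite prodA1E; elim/big_rec: _ => [|j x jk IHx]; first exact: coprimen1.
by rewrite coprimeMr IHx a_coprime // eq_sym.
Qed.

Lemma dvdn_prodAP x : reflect (forall k, (a k %| x)%N) (A %| x)%N.
Proof.
have a_pairwise_coprime :
    pairwise coprime [seq a k | k <- index_enum 'I_n & xpredT k].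
  rewrite filter_predT pairwise_map.
  have := index_enum_uniq 'I_n; rewrite uniq_pairwise.
  by apply: sub_pairwise => j k; exact: a_coprime.
apply: (iffP (unstable.Gauss_dvd_prod x a_pairwise_coprime)) => a_dvd k.
  by apply: a_dvd; rewrite ?mem_index_enum.
by move=> *; apply: a_dvd.
Qed.

Lemma dvdn_add_sum_prodA1 m r k :
  (a k %| r + \sum_j m j * A_ j)%N = (a k %| r + m k * A_ k)%N.
Proof.
rewrite (bigD1 k) //= addnA dvdn_addl //.
by apply: dvdn_sum => j jk; rewrite dvdn_mull // dvdn_prodA1 // eq_sym.
Qed.

Definition digit r k : nat := (neg_inv_mod (a k) (A_ k) * r %% a k)%N.

(* An exact quotient, by [level_mul]. *)
Definition level r : nat := ((r + \sum_k digit r k * A_ k) %/ A)%N.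

Lemma neg_inv_prodA1P k : (a k %| A_ k * neg_inv_mod (a k) (A_ k) + 1)%N.
Proof. exact: neg_inv_modP (a_gt0 k) (coprime_prodA1 k). Qed.

Lemma dvdn_prodA_digitP m r :
  reflect (forall k, m k %% a k = digit r k)%N (A %| r + \sum_k m k * A_ k)%N.
Proof.
have coordE k : (a k %| r + \sum_j m j * A_ j)%N = (m k %% a k == digit r k)%N.
  by rewrite dvdn_add_sum_prodA1 (dvdn_addM_neg_inv _ _ (neg_inv_prodA1P k)).
apply: (iffP (dvdn_prodAP _)) => residue k.
  by apply/eqP; rewrite -coordE.
by rewrite coordE; apply/eqP.
Qed.

Lemma level_mul r : (level r * A)%N = (r + \sum_k digit r k * A_ k)%N.
Proof. by apply/divnK/dvdn_prodA_digitP => k; rewrite modn_mod. Qed.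

Lemma level_le r : (r < A)%N -> (level r <= n)%N.
Proof.
move=> r_lt; rewrite -ltnS -(ltn_pmul2r prodA_gt0) level_mul mulSn -addSn.
rewrite leq_add // -[X in (_ <= X * _)%N]card_ord -sum_nat_const.
apply: leq_sum => k _; rewrite -(mul_prodA1 k) leq_mul2r.
by rewrite ltnW ?orbT ?ltn_pmod.
Qed.

Lemma level_natr (F : numFieldType) r :
  (level r)%:R = \sum_k (digit r k)%:R / (a k)%:R + r%:R / A%:R :> F.
Proof.
have A0 : A%:R != 0 :> F by rewrite pnatr_eq0 -lt0n prodA_gt0.
apply: (mulIf A0); rewrite mulrDl divfK // -natrM level_mul natrD addrC.
congr (_ + _); rewrite natr_sum mulr_suml; apply: eq_bigr => k _.
rewrite natrM -(mul_prodA1 k) natrM.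
by field; rewrite pnatr_eq0 -lt0n.
Qed.

Lemma level_centered (F : numFieldType) r :
  (level r)%:R - (n%:R + 1) / 2 =
  \sum_k centered F (a k) (digit r k) + centered F A r.
Proof.
have A0 : A%:R != 0 :> F by rewrite pnatr_eq0 -lt0n prodA_gt0.
by rewrite level_natr /centered sumrB sumr_const card_ord -mulr_natr; field.
Qed.

Definition class_point r q : {ffun 'I_n -> int} :=
  [ffun k => (digit r k + a k * q k)%N%:Z].

Lemma sum_class_point r q :
  (r + \sum_k (digit r k + a k * q k) * A_ k)%N =
  ((level r + \sum_k q k) * A)%N.
Proof.
rewrite mulnDl level_mul -addnA big_distrl -big_split /=; congr addn.
by apply: eq_bigr => k _; rewrite -(mul_prodA1 k); ring.
Qed.

Lemma sum_frac_le m t :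
  (\sum_k (m k)%:Z%:~R / (a k)%:R <= t%:R :> rat) =
  (\sum_k m k * A_ k <= t * A)%N.
Proof.
have A0 : (0 : rat) < A%:R by rewrite ltr0n prodA_gt0.
rewrite -(ler_pM2r A0) -natrM -(ler_nat rat) mulr_suml natr_sum.
congr (_ <= _); apply: eq_bigr => k _.
rewrite natrM -pmulrn -(mul_prodA1 k) natrM.
by field; rewrite pnatr_eq0 -lt0n.
Qed.

Lemma class_point_simplex r q t : (r < A)%N ->
  simplex_points a t (class_point r q) <-> (level r + \sum_k q k <= t)%N.
Proof.
move=> r_lt; rewrite /simplex_points /=.
under eq_bigr => k _ do rewrite ffunE.
rewrite sum_frac_le.
set M := (\sum_k _ * _)%N; set w := (level r + _)%N.
have ME : (r + M = w * A)%N by exact: sum_class_point.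
have -> : (M <= t * A)%N = (w <= t)%N.
  apply/idP/idP => [M_le|w_le].
    by rewrite -ltnS -(ltn_pmul2r prodA_gt0) -ME mulSn -addSn leq_add.
  by rewrite (leq_trans (leq_addl r M)) // ME leq_mul2r w_le orbT.
by split=> [[]|w_le] //; split=> // k; rewrite ffunE.
Qed.

Lemma class_point_inj r r' q q' : (r < A)%N -> (r' < A)%N ->
  class_point r q = class_point r' q' -> r = r' /\ q =1 q'.
Proof.
move=> r_lt r'_lt /ffunP point_eq.
have coord_eq k : (digit r k + a k * q k = digit r' k + a k * q' k)%N.
  by have := point_eq k; rewrite !ffunE => -[].
have r_eq : r = r'.
  have := sum_class_point r' q'.
  under eq_bigr => k _ do rewrite -coord_eq.
  set M := (\sum_k _ * _)%N => ME'.
  have ME : (r + M)%N = _ := sum_class_point r q.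
  by apply/eqP; rewrite -(modn_small r_lt) -(modn_small r'_lt) -(eqn_modDr M)
    ME ME' !modnMl.
split=> // k; apply/eqP; rewrite -(eqn_pmul2l (a_gt0 k)).
by rewrite -(eqn_add2l (digit r k)) coord_eq r_eq.
Qed.

Lemma class_point_surj (m : {ffun 'I_n -> int}) : (forall k, 0 <= m k) ->
  exists r q, (r < A)%N /\ m = class_point r q.
Proof.
move=> m_ge0; pose m' k := `|m k|%N; pose M := (\sum_k m' k * A_ k)%N.
pose r := (M * A.-1 %% A)%N; exists r, (fun k => m' k %/ a k)%N.
split; first by rewrite ltn_pmod // prodA_gt0.
have /dvdn_prodA_digitP digitE : (A %| r + M)%N.
  rewrite /dvdn modnDml -[X in (_ + X)%N]muln1 -mulnDr addn1.
  by rewrite prednK ?prodA_gt0 // modnMl.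
apply/ffunP => k; rewrite ffunE -digitE addnC mulnC -divn_eq.
by rewrite gez0_abs.
Qed.

Lemma lattice_count_card t :
  lattice_count a t =
  #|[pred p : 'I_A * n.-tuple 'I_t.+1 |
      (level p.1 + \sum_k tnth p.2 k <= t)%N]|.
Proof.
set D := [pred p : _ | _].
pose f (p : 'I_A * n.-tuple 'I_t.+1) := class_point p.1 (tnth p.2).
have f_inj : injective f.
  move=> [r q] [r' q'] /class_point_inj [] //= /val_inj <- q_eq.
  by congr pair; apply: eq_from_tnth => k; apply/val_inj/q_eq.
suff -> : lattice_count a t = #|` [fset f p | p in D]%fset |.
  by rewrite card_imfset //= cardE.
congr #|` _|%fset; apply/fsetP => m.
rewrite in_fset_set; last exact: finite_simplex_points.
apply/idP/imfsetP => [|[[r q] /= q_le ->]]; rewrite in_setE; last first.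
  exact/class_point_simplex.
move=> m_simplex; have [r [q [r_lt mE]]] := class_point_surj m_simplex.1.
move: m_simplex; rewrite mE => /(class_point_simplex _ _ r_lt) q_le.
have q_lt k : (q k < t.+1)%N.
  by rewrite ltnS (leq_trans _ q_le) // (bigD1 k) //= addnCA leq_addr.
exists (Ordinal r_lt, [tuple Ordinal (q_lt k) | k < n]) => /=.
  by rewrite inE /=; under eq_bigr => k _ do rewrite tnth_mktuple.
by apply/ffunP => k; rewrite !ffunE tnth_mktuple.
Qed.

Lemma lattice_countE t :
  lattice_count a t = (\sum_(r < A) 'C(t + (n - level r), n))%N.
Proof.
rewrite lattice_count_card -sum1_card.
rewrite -(pair_big_dep xpredT
  (fun (r : 'I_A) (q : n.-tuple 'I_t.+1) => level r + \sum_k tnth q k <= t)%N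
  (fun _ _ => 1%N)).
apply: eq_bigr => r _; rewrite sum1_card.
have r_le := level_le (ltn_ord r); have [r_gt|r_let] := ltnP t (level r).
  rewrite bin_small; last by lia.
  by apply: eq_card0 => q; rewrite !inE; apply/negbTE; rewrite -ltnNge ltn_addr.
have -> : (t + (n - level r) = n + (t - level r))%N by lia.
rewrite -(card_tuple_sum_le n (leq_subr (level r) t)).
by apply: eq_card => q; rewrite !inE leq_subRL.
Qed.

(** * Equidistribution of the digits *)

Lemma coprime_neg_inv k : coprime (a k) (neg_inv_mod (a k) (A_ k)).
Proof. exact: dvdn_addn1_coprime (neg_inv_prodA1P k). Qed.

Lemma digitDM x y k : digit (x + a k * y) k = digit x k.
Proof. by rewrite /digit mulnDr mulnCA addnC mulnC modnMDl. Qed.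

Lemma sum_digit (V : nmodType) (g : nat -> V) k :
  \sum_(r < A) g (digit r k) = (\sum_(z < a k) g z) *+ A_ k.
Proof.
rewrite -(mul_prodA1 k).
exact: (sum_affine_modn_muln g 0 _ (a_gt0 k) (coprime_neg_inv k)).
Qed.

Lemma sum_digitM (F : comPzRingType) (f g : nat -> F) j k : j != k ->
  \sum_(r < A) f (digit r j) * g (digit r k) =
  (prodA2 a j k)%:R * (\sum_(x < a j) f x) * (\sum_(y < a k) g y).
Proof.
move=> jk; rewrite -(mul_prodA1 j).
rewrite (big_ord_muln _ _ (fun r => f (digit r j) * g (digit r k))).
rewrite -(sum_affine_modn f 0 (a_gt0 j) (coprime_neg_inv j)).
rewrite -mulrA mulrC -mulrA mulr_suml; apply: eq_bigr => x _.
under eq_bigr => y _ do rewrite digitDM.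
rewrite -mulr_sumr; congr (_ * _); rewrite -(mul_prodA2 jk) mulr_natr.
have co : coprime (a k) (neg_inv_mod (a k) (A_ k) * a j).
  by rewrite coprimeMr coprime_neg_inv a_coprime // eq_sym.
rewrite -(sum_affine_modn_muln g (neg_inv_mod (a k) (A_ k) * x) _ (a_gt0 k) co).
by apply: eq_bigr => y _; rewrite /digit mulnDr mulnA.
Qed.

Lemma sum_digit_centered (F : numFieldType) (g : nat -> F) k :
  \sum_(r < A) g (digit r k) * centered F A r =
  \sum_(x < a k) g (digit x k) * centered F (a k) x.
Proof.
rewrite -(mul_prodA1 k).
rewrite (big_ord_muln _ _ (fun r => g (digit r k) * centered F (a k * A_ k) r)).
apply: eq_bigr => x _; under eq_bigr => y _ do rewrite digitDM.
by rewrite -mulr_sumr sum_centered_progression ?prodA1_gt0.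
Qed.

End LatticePoints.

(** * The Ehrhart polynomial *)

Lemma ffact_natr (R : comPzRingType) (x m : nat) :
  (x ^_ m)%:R = \prod_(l < m) (x%:R - l%:R) :> R.
Proof.
elim: m => [|m IHm]; first by rewrite big_ord0.
rewrite ffactnSr natrM big_ord_recr /= -IHm.
have [m_le|x_lt] := leqP m x; first by rewrite natrB.
by rewrite ffact_small // !mul0r.
Qed.

Lemma eq_poly_pos_nat (R : numDomainType) (p q : {poly R}) :
  (forall t : nat, (0 < t)%N -> p.[t%:R] = q.[t%:R]) -> p = q.
Proof.
move=> pq; apply/eqP; rewrite -subr_eq0; apply/negPn/negP => d_neq0.
pose rs := [seq i%:R : R | i <- iota 1 (size (p - q))].
suff: (size rs < size (p - q)%R)%N by rewrite size_map size_iota ltnn.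
apply: max_poly_roots d_neq0 _ _.
  apply/allP => _ /mapP [i + ->]; rewrite mem_iota => /andP [i_gt0 _].
  by rewrite /root hornerD hornerN pq ?subrr.
by rewrite map_inj_uniq ?iota_uniq // => i j /eqP; rewrite eqr_nat => /eqP.
Qed.

(* The falling factorial of ['X + x]. *)
Definition ffact_poly (R : nzRingType) (x : R) (m : nat) : {poly R} :=
  \prod_(l < m) ('X - (l%:R - x)%:P).

Lemma horner_ffact_poly (R : comNzRingType) (i t m : nat) :
  (ffact_poly (i%:R : R) m).[t%:R] = ((t + i) ^_ m)%:R.
Proof.
rewrite ffact_natr horner_prod; apply: eq_bigr => l _.
by rewrite hornerXsubC natrD opprB addrA.
Qed.

Lemma coef_ffact_polyS (R : nzRingType) (x : R) m i :
  (ffact_poly x m.+1)`_i =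
  (if i is j.+1 then (ffact_poly x m)`_j else 0)
  + (ffact_poly x m)`_i * (x - m%:R).
Proof.
rewrite /ffact_poly big_ord_recr /= mulrBr coefB coefMX coefMC -mulrN opprB.
by case: i.
Qed.

Lemma coef_ffact_poly_deg (R : nzRingType) (x : R) m :
  (ffact_poly x m)`_m = 1.
Proof.
rewrite /ffact_poly -(big_mkord xpredT (fun l => 'X - (l%:R - x)%:P)).
have /monicP := monic_prod_XsubC (index_iota 0 m) xpredT (fun l => l%:R - x).
by rewrite lead_coefE size_prod_XsubC size_iota subn0.
Qed.

Lemma coef_ffact_poly_deg1 (R : numFieldType) (x : R) m :
  (ffact_poly x m.+1)`_m = m.+1%:R * (x - m%:R / 2).
Proof.
elim: m => [|m IHm]; rewrite coef_ffact_polyS coef_ffact_poly_deg mul1r.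
  by ring.
by rewrite IHm -[m.+2%:R]natr1 -[m.+1%:R]natr1; field.
Qed.

Lemma coef_ffact_poly_deg2 (R : numFieldType) (x : R) m :
  (ffact_poly x m.+2)`_m =
  (m.+2 * m.+1)%:R / 2 * ((x - m.+1%:R / 2) ^+ 2 - m.+3%:R / 12).
Proof.
elim: m => [|m IHm]; rewrite coef_ffact_polyS coef_ffact_poly_deg1.
  by field.
rewrite IHm !natrM -[m.+4%:R]natr1 -[m.+3%:R]natr1 -[m.+2%:R]natr1.
by rewrite -[m.+1%:R]natr1; field.
Qed.

Definition ehrhart_poly (R : numFieldType) (n : nat) (a : 'I_n -> nat) :
    {poly R} :=
  n`!%:R^-1 *: \sum_(r < prodA a) ffact_poly (n - level a r)%:R n.

Section EhrhartPoly.
Context {R : realType} {n : nat} (a : 'I_n -> nat).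
Hypothesis a_gt0 : forall k, (0 < a k)%N.
Hypothesis a_coprime : forall j k, j != k -> coprime (a j) (a k).
Local Notation A := (prodA a).
Local Notation A_ := (prodA1 a).
Local Notation digit := (digit a).
Local Notation level := (level a).
Local Notation centered := (centered R).

Lemma horner_ehrhart_poly (t : nat) :
  (ehrhart_poly R a).[t%:R] = (lattice_count a t)%:R.
Proof.
have fact_neq0 : n`!%:R != 0 :> R by rewrite pnatr_eq0 -lt0n fact_gt0.
rewrite lattice_countE // hornerZ horner_sum natr_sum mulr_sumr.
apply: eq_bigr => r _; apply: (mulfI fact_neq0).
by rewrite mulVKf // horner_ffact_poly -bin_ffact natrM mulrC.
Qed.

Lemma coef_ehrhart_poly_deg2 : (2 <= n)%N ->
  (ehrhart_poly R a)`_(n - 2) =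
  (n - 2)`!%:R^-1 *
  \sum_(r < A) (((level r)%:R - (n%:R + 1) / 2) ^+ 2 - (n%:R + 1) / 12) / 2.
Proof.
move=> n_ge2; have [m nE] : exists m, n = m.+2 by exists (n - 2)%N; lia.
rewrite coefZ coef_sum !mulr_sumr; apply: eq_bigr => r _.
rewrite natrB; last exact: level_le.
move: (level r : nat) => i.
rewrite nE subn2 /= coef_ffact_poly_deg2 !factS mulnA natrM natr1.
have fact_neq0 : m`!%:R != 0 :> R by rewrite pnatr_eq0 -lt0n fact_gt0.
rewrite -[m.+3%:R]natr1 -[m.+2%:R]natr1.
by field; rewrite fact_neq0 nat1r -natrD !pnatr_eq0.
Qed.

Lemma sum_centered_digit_sqr k :
  \sum_(r < A) centered (a k) (digit r k) ^+ 2 =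
  A%:R / 12 + (A_ k)%:R / (6 * (a k)%:R).
Proof.
have a0 : (a k)%:R != 0 :> R by rewrite pnatr_eq0 -lt0n.
rewrite (sum_digit a_gt0 a_coprime (fun z => centered (a k) z ^+ 2)).
by rewrite sum_centered_sqr // -mulr_natr -(mul_prodA1 a_gt0 k) natrM; field.
Qed.

Lemma sum_centered_digitM j k : j != k ->
  \sum_(r < A) centered (a j) (digit r j) * centered (a k) (digit r k) =
  (prodA2 a j k)%:R / 4.
Proof.
move=> jk.
rewrite (sum_digitM a_gt0 a_coprime (centered (a j)) (centered (a k)) jk).
by rewrite !sum_centered //; field.
Qed.

Lemma sum_centered_digit_residue k :
  \sum_(r < A) centered (a k) (digit r k) * centered A r =
  4^-1 - dedekind_sum R (A_ k)%:Z (a k).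
Proof.
rewrite sum_digit_centered //.
rewrite (dedekind_sum_neg_inv (a_gt0 k) (neg_inv_prodA1P a_gt0 a_coprime k)).
rewrite opprK sum_sawtoothM //; last exact: coprime_neg_inv.
by rewrite addrC subrK; apply: eq_bigr => x _; rewrite mulrC.
Qed.

Lemma sqr_level_centered r :
  ((level r)%:R - (n%:R + 1) / 2) ^+ 2 =
  \sum_k centered (a k) (digit r k) ^+ 2
  + (\sum_(j < n) \sum_(k < n | (j < k)%N)
       centered (a j) (digit r j) * centered (a k) (digit r k)) *+ 2
  + (\sum_k centered (a k) (digit r k) * centered A r) *+ 2
  + centered A r ^+ 2.
Proof. by rewrite level_centered // sqrrD sqr_sum mulr_suml. Qed.

Lemma sum_sqr_level :
  \sum_(r < A) (((level r)%:R - (n%:R + 1) / 2) ^+ 2 - (n%:R + 1) / 12) / 2 =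
  constC R a - \sum_k dedekind_sum R (A_ k)%:Z (a k).
Proof.
have A0 : A%:R != 0 :> R by rewrite pnatr_eq0 -lt0n prodA_gt0.
under eq_bigr => r _ do rewrite sqr_level_centered.
rewrite -mulr_suml sumrB !big_split /= sum_centered_sqr ?prodA_gt0 //.
have -> : \sum_(r < A) \sum_k centered (a k) (digit r k) ^+ 2 =
    n%:R * A%:R / 12 + (\sum_k (A_ k)%:R / (a k)%:R) / 6.
  rewrite exchange_big /=.
  under eq_bigr => k _ do rewrite sum_centered_digit_sqr.
  rewrite big_split sumr_const card_ord mulr_suml /=; congr (_ + _).
    by rewrite -[LHS]mulr_natl mulrA.
  by apply: eq_bigr => k _; field; rewrite pnatr_eq0 -lt0n.
have -> : \sum_(r < A) \sum_(j < n) \sum_(k < n | (j < k)%N)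
      centered (a j) (digit r j) * centered (a k) (digit r k) =
    (\sum_(j < n) \sum_(k < n | (j < k)%N) (prodA2 a j k)%:R) / 4.
  rewrite exchange_big mulr_suml; apply: eq_bigr => j _.
  rewrite exchange_big /= mulr_suml; apply: eq_bigr => k jk.
  by rewrite sum_centered_digitM // -val_eqE /= ltn_eqF.
have -> : \sum_(r < A) \sum_k centered (a k) (digit r k) * centered A r =
    n%:R / 4 - \sum_k dedekind_sum R (A_ k)%:Z (a k).
  rewrite exchange_big /=.
  under eq_bigr => k _ do rewrite sum_centered_digit_residue.
  by rewrite sumrB sumr_const card_ord -[4^-1 *+ n]mulr_natl.
rewrite sumr_const card_ord -[_ *+ A]mulr_natr /constC.
by field.
Qed.

End EhrhartPoly.

Theorem theorem7 (R : realType) (n : nat) (hn : (3 <= n)%N) (a : 'I_n -> nat)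
    (ha2 : forall k, (2 <= a k)%N)
    (hacop : forall j k, j != k -> coprime (a j) (a k))
    (c : {poly R}) (hcdeg : (size c <= n.+1)%N)
    (hc : forall t : nat, (0 < t)%N -> c.[t%:R] = (lattice_count a t)%:R) :
  c`_(n - 2) =
    1 / ((n - 2)`!)%:R *
      (constC R a - \sum_(k < n) dedekind_sum R (prodA1 a k)%:Z (a k)).
Proof.
have a_gt0 k : (0 < a k)%N by exact: ltnW (ha2 k).
have -> : c = ehrhart_poly R a.
  by apply: eq_poly_pos_nat => t t_gt0; rewrite hc // horner_ehrhart_poly.
by rewrite coef_ehrhart_poly_deg2 ?(ltnW hn) // sum_sqr_level // div1r.
Qed.
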